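(* Let $\phi\vdash\psi$ be an $\mathcal{L}_{\mathrm{SI}}$-sequent and $\chi\vdash\delta$ an $\mathcal{L}_\bullet$-sequent. If the rule $$\frac{\Rightarrow\phi\vdash\psi}{\Rightarrow\chi\vdash\delta}$$ is derivable in $\mathsf{ALC}$, then $\phi\vdash\psi$ algebraically corresponds to $\chi\vdash\delta$ over BDRGs, i.e. the two sequents are valid in exactly the same BDRGs.
   Context: Languages. Formulas are built from propositional variables and the constants $\top,\bot$: $\mathcal{L}_{\mathrm{SI}}$ uses $\wedge,\vee,\to$; $\mathcal{L}_{\mathrm{LC}}$ uses $\wedge,\vee,\to,\bullet,\leftarrow$; $\mathcal{L}_\bullet$ uses only $\bullet$. A sequent is $\phi\vdash\psi$ with $\phi,\psi$ formulas; an $\mathcal{L}_{\mathrm{LC}}$-supersequent is $\Theta\Rightarrow\chi\vdash\delta$ with $\Theta$ a set of $\mathcal{L}_{\mathrm{LC}}$-sequents (written without $\Theta$ if it is empty). A BDRG is an algebra $(A,\wedge,\vee,\top,\bot,\to,\bullet,\leftarrow)$ such that $(A,\wedge,\vee,\top,\bot)$ is a bounded distributive lattice and, for all $a,b,c\in A$: $a\bullet b\le c$ iff $b\le a\to c$ iff $a\le c\leftarrow b$. A sequent $\phi\vdash\psi$ is valid in a BDRG if $\mu(\phi)\le\mu(\psi)$ for every assignment $\mu$. Calculus $\mathsf{ALC}$. It acts on $\mathcal{L}_{\mathrm{LC}}$-supersequents; in each rule $S/\!/S'$ below, $S$ and $S'$ may be derived from each other. A rule is derivable in $\mathsf{ALC}$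 if its conclusion has a derivation from its premiss using only rules of $\mathsf{ALC}$. Rules changing only one assumption (the rest $\Theta\Rightarrow\chi\vdash\delta$ is unchanged): Splitting: $\gamma\vdash\phi\wedge\psi$ $/\!/$ $\gamma\vdash\phi,\ \gamma\vdash\psi$; $\phi\vee\psi\vdash\gamma$ $/\!/$ $\phi\vdash\gamma,\ \psi\vdash\gamma$. Residuation: $\psi\vdash\phi\to\gamma$ $/\!/$ $\phi\bullet\psi\vdash\gamma$; $\phi\vdash\gamma\leftarrow\psi$ $/\!/$ $\phi\bullet\psi\vdash\gamma$. Approximation, with $p$ a fresh variable (not occurring in the previous derivation): $\phi\to\psi\vdash\gamma$ $/\!/$ $p\vdash\phi,\ p\to\psi\vdash\gamma$; $\phi\to\psi\vdash\gamma$ $/\!/$ $\psi\vdash p,\ \phi\to p\vdash\gamma$; $\gamma\vdash\phi\to\psi$ $/\!/$ $\phi\vdash p,\ \gamma\vdash p\to\psi$; $\gamma\vdash\phi\to\psi$ $/\!/$ $p\vdash\psi,\ \gamma\vdash\phi\to p$; $\phi\vdash\psi\bullet\gamma$ $/\!/$ $p\vdash\psi,\ \phi\vdash p\bullet\gamma$; $\phi\vdash\psi\bullet\gamma$ $/\!/$ $p\vdash\gamma,\ \phi\vdash\psi\bullet p$; $\phi\bullet\psi\vdash\gamma$ $/\!/$ $\phi\vdash p,\ p\bullet\psi\vdash\gamma$; $\phi\bullet\psi\vdash\gamma$ $/\!/$ $\psi\vdash p,\ \phi\bullet p\vdash\gamma$; $\phi\wedge\psi\vdash\gamma$ $/\!/$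 $\phi\vdash p,\ p\wedge\psi\vdash\gamma$; $\phi\wedge\psi\vdash\gamma$ $/\!/$ $\psi\vdash p,\ \phi\wedge p\vdash\gamma$; $\phi\vdash\psi\vee\gamma$ $/\!/$ $p\vdash\psi,\ \phi\vdash p\vee\gamma$; $\phi\vdash\psi\vee\gamma$ $/\!/$ $p\vdash\gamma,\ \phi\vdash\psi\vee p$. Rules involving the conclusion: $\Theta\Rightarrow\psi\vdash\phi\to\gamma$ $/\!/$ $\Theta\Rightarrow\phi\bullet\psi\vdash\gamma$; $\Theta\Rightarrow\phi\vdash\gamma\leftarrow\psi$ $/\!/$ $\Theta\Rightarrow\phi\bullet\psi\vdash\gamma$; and for fresh $p$: $\Theta\Rightarrow\phi\vdash\psi$ $/\!/$ $p\vdash\phi,\Theta\Rightarrow p\vdash\psi$; $\Theta\Rightarrow\phi\vdash\psi$ $/\!/$ $\psi\vdash p,\Theta\Rightarrow\phi\vdash p$. Ackermann rules: (RAck) $\phi_1\vdash p,\dots,\phi_n\vdash p,\Theta,\Theta'\Rightarrow\chi\vdash\delta$ $/\!/$ $\Theta[\alpha/p],\Theta'\Rightarrow(\chi\vdash\delta)[\alpha/p]$ with $\alpha=\bigvee_{i=1}^n\phi_i$, provided $p$ does not occur in $\Theta'$ or any $\phi_i$, each sequent $\psi_j\vdash\gamma_j$ in the finite set $\Theta$ has $\psi_j$ positive and $\gamma_j$ negative in $p$, and either $p$ does not occur in $\chi\vdash\delta$ or $\chi\vdash\delta$ is positive in $p$ ($\chi$ negative and $\delta$ positive in $p$). (LAck)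 $p\vdash\phi_1,\dots,p\vdash\phi_n,\Theta,\Theta'\Rightarrow\chi\vdash\delta$ $/\!/$ $\Theta[\alpha/p],\Theta'\Rightarrow(\chi\vdash\delta)[\alpha/p]$ with $\alpha=\bigwedge_{i=1}^n\phi_i$, provided $p$ does not occur in $\Theta'$ or any $\phi_i$, each $\psi_j\vdash\gamma_j$ in the finite set $\Theta$ has $\psi_j$ negative and $\gamma_j$ positive in $p$, and either $p$ does not occur in $\chi\vdash\delta$ or $\chi\vdash\delta$ is negative in $p$ ($\chi$ positive and $\delta$ negative in $p$). *)

(* Defs.v *)
From HB Require Import structures.
From Stdlib Require List.
From mathcomp Require Import all_boot all_order.
From mathcomp Require Import boolp classical_sets functions cardinality.

Set Implicit Arguments.
Unset Strict Implicit.
Unset Printing Implicit Defensive.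

Local Open Scope classical_set_scope.

(* Formulas of L_LC; [Res a c] is a -> c and [Cores c b] is c <- b. *)
Inductive formula : Type :=
  | Var of nat
  | Top
  | Bot
  | And of formula & formula
  | Or of formula & formula
  | Res of formula & formula
  | Fus of formula & formula
  | Cores of formula & formula.

Declare Scope formula_scope.
Delimit Scope formula_scope with F.
Bind Scope formula_scope with formula.

Notation "phi /\ psi" := (And phi psi) : formula_scope.
Notation "phi \/ psi" := (Or phi psi) : formula_scope.
Notation "phi ==> psi" := (Res phi psi) : formula_scope.
Notation "phi • psi" := (Fus phi psi)
  (at level 50, left associativity) : formula_scope.
Notation "phi <== psi" := (Cores phi psi)
  (at level 55, right associativity) : formula_scope.

Fixpoint in_LSI (phi : formula) : bool :=
  match phi with
  | Var _ | Top | Bot => true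
  | And a b | Or a b | Res a b => in_LSI a && in_LSI b
  | Fus _ _ | Cores _ _ => false
  end.

Fixpoint in_Lbullet (phi : formula) : bool :=
  match phi with
  | Var _ | Top | Bot => true
  | Fus a b => in_Lbullet a && in_Lbullet b
  | And _ _ | Or _ _ | Res _ _ | Cores _ _ => false
  end.

Record sequent : Type := Sequent { lhs : formula; rhs : formula }.

Notation "phi ⊢ psi" := (Sequent phi%F psi%F)
  (at level 90, no associativity).

Definition LSI_sequent (s : sequent) : bool := in_LSI (lhs s) && in_LSI (rhs s).

Definition Lbullet_sequent (s : sequent) : bool :=
  in_Lbullet (lhs s) && in_Lbullet (rhs s).

Record supersequent : Type :=
  Supersequent { assumptions : set sequent; conclusion : sequent }.

Notation "Theta ⇒ s" := (Supersequent Theta s)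
  (at level 95, no associativity).

HB.mixin Record TBDistrLattice_isBDRG d A of Order.TBDistrLattice d A := {
  fus : A -> A -> A;
  res : A -> A -> A;
  cores : A -> A -> A;
  fus_res : forall a b c : A, (fus a b <= c)%O = (b <= res a c)%O;
  fus_cores : forall a b c : A, (fus a b <= c)%O = (a <= cores c b)%O
}.

#[short(type="bdrgType")]
HB.structure Definition BDRG d :=
  { A of TBDistrLattice_isBDRG d A & Order.TBDistrLattice d A }.

Fixpoint eval d (A : bdrgType d) (mu : nat -> A) (phi : formula) : A :=
  match phi with
  | Var p => mu p
  | Top => Order.top
  | Bot => Order.bottom
  | And a b => Order.meet (eval mu a) (eval mu b)
  | Or a b => Order.join (eval mu a) (eval mu b)
  | Res a b => res (eval mu a) (eval mu b)
  | Fus a b => fus (eval mu a) (eval mu b)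
  | Cores a b => cores (eval mu a) (eval mu b)
  end.

Definition valid d (A : bdrgType d) (s : sequent) : Prop :=
  forall mu : nat -> A, (eval mu (lhs s) <= eval mu (rhs s))%O.

Definition algebraically_corresponds (s t : sequent) : Prop :=
  forall (d : Order.disp_t) (A : bdrgType d), valid A s <-> valid A t.

Fixpoint occurs (p : nat) (phi : formula) : bool :=
  match phi with
  | Var q => q == p
  | Top | Bot => false
  | And a b | Or a b | Res a b | Fus a b | Cores a b => occurs p a || occurs p b
  end.

Definition occurs_seq (p : nat) (s : sequent) : bool :=
  occurs p (lhs s) || occurs p (rhs s).

Definition occurs_sup (p : nat) (S : supersequent) : Prop :=
  (exists2 s, assumptions S s & occurs_seq p s)
  \/ occurs_seq p (conclusion S).

(* [signed b p phi]: every occurrence of p in phi is positive if b, negative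
   otherwise; it holds vacuously when p does not occur. *)
Fixpoint signed (b : bool) (p : nat) (phi : formula) : bool :=
  match phi with
  | Var q => b || (q != p)
  | Top | Bot => true
  | And x y | Or x y | Fus x y => signed b p x && signed b p y
  | Res x y => signed (~~ b) p x && signed b p y
  | Cores x y => signed b p x && signed (~~ b) p y
  end.

Notation positive := (signed true).
Notation negative := (signed false).

Definition positive_seq (p : nat) (s : sequent) : bool :=
  negative p (lhs s) && positive p (rhs s).

Definition negative_seq (p : nat) (s : sequent) : bool :=
  positive p (lhs s) && negative p (rhs s).

Fixpoint subst (alpha : formula) (p : nat) (phi : formula) : formula :=
  match phi with
  | Var q => if q == p then alpha else Var q
  | Top => Top
  | Bot => Bot
  | And a b => And (subst alpha p a) (subst alpha p b)
  | Or a b => Or (subst alpha p a) (subst alpha p b)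
  | Res a b => Res (subst alpha p a) (subst alpha p b)
  | Fus a b => Fus (subst alpha p a) (subst alpha p b)
  | Cores a b => Cores (subst alpha p a) (subst alpha p b)
  end.

Definition subst_seq (alpha : formula) (p : nat) (s : sequent) : sequent :=
  subst alpha p (lhs s) ⊢ subst alpha p (rhs s).

(* Finite disjunctions and conjunctions: associated to the left, equal to the
   formula itself for a singleton (no unit is appended), and to the unit for
   the empty list. *)
Definition bigOr (Phi : seq formula) : formula :=
  if Phi is phi :: Phi' then foldl Or phi Phi' else Bot.

Definition bigAnd (Phi : seq formula) : formula :=
  if Phi is phi :: Phi' then foldl And phi Phi' else Top.

(* Each relation below lists instances (S, S') of the two-way rules S // S';
   the direction of use and the freshness conditions are imposed in [step]. *)

Inductive split_residuate : sequent -> set sequent -> Prop :=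
  | SplitAnd phi psi gamma :
      split_residuate (gamma ⊢ phi /\ psi) [set gamma ⊢ phi; gamma ⊢ psi]
  | SplitOr phi psi gamma :
      split_residuate (phi \/ psi ⊢ gamma) [set phi ⊢ gamma; psi ⊢ gamma]
  | Residuate phi psi gamma :
      split_residuate (psi ⊢ phi ==> gamma) [set phi • psi ⊢ gamma]
  | Coresiduate phi psi gamma :
      split_residuate (phi ⊢ gamma <== psi) [set phi • psi ⊢ gamma].

Inductive approximate (p : nat) : sequent -> set sequent -> Prop :=
  | ApproxResL1 phi psi gamma :
      approximate p (phi ==> psi ⊢ gamma)
                    [set Var p ⊢ phi; Var p ==> psi ⊢ gamma]
  | ApproxResL2 phi psi gamma :
      approximate p (phi ==> psi ⊢ gamma)
                    [set psi ⊢ Var p; phi ==> Var p ⊢ gamma]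
  | ApproxResR1 phi psi gamma :
      approximate p (gamma ⊢ phi ==> psi)
                    [set phi ⊢ Var p; gamma ⊢ Var p ==> psi]
  | ApproxResR2 phi psi gamma :
      approximate p (gamma ⊢ phi ==> psi)
                    [set Var p ⊢ psi; gamma ⊢ phi ==> Var p]
  | ApproxFusR1 phi psi gamma :
      approximate p (phi ⊢ psi • gamma)
                    [set Var p ⊢ psi; phi ⊢ Var p • gamma]
  | ApproxFusR2 phi psi gamma :
      approximate p (phi ⊢ psi • gamma)
                    [set Var p ⊢ gamma; phi ⊢ psi • Var p]
  | ApproxFusL1 phi psi gamma :
      approximate p (phi • psi ⊢ gamma)
                    [set phi ⊢ Var p; Var p • psi ⊢ gamma]
  | ApproxFusL2 phi psi gamma :
      approximate p (phi • psi ⊢ gamma)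
                    [set psi ⊢ Var p; phi • Var p ⊢ gamma]
  | ApproxAnd1 phi psi gamma :
      approximate p (phi /\ psi ⊢ gamma)
                    [set phi ⊢ Var p; Var p /\ psi ⊢ gamma]
  | ApproxAnd2 phi psi gamma :
      approximate p (phi /\ psi ⊢ gamma)
                    [set psi ⊢ Var p; phi /\ Var p ⊢ gamma]
  | ApproxOr1 phi psi gamma :
      approximate p (phi ⊢ psi \/ gamma)
                    [set Var p ⊢ psi; phi ⊢ Var p \/ gamma]
  | ApproxOr2 phi psi gamma :
      approximate p (phi ⊢ psi \/ gamma)
                    [set Var p ⊢ gamma; phi ⊢ psi \/ Var p].

Inductive rule : supersequent -> supersequent -> Prop :=
  | RuleSplitResiduate s Gamma Theta c :
      split_residuate s Gamma ->
      rule (s |` Theta ⇒ c) (Gamma `|` Theta ⇒ c)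
  | RuleResiduateConcl Theta phi psi gamma :
      rule (Theta ⇒ psi ⊢ phi ==> gamma) (Theta ⇒ phi • psi ⊢ gamma)
  | RuleCoresiduateConcl Theta phi psi gamma :
      rule (Theta ⇒ phi ⊢ gamma <== psi) (Theta ⇒ phi • psi ⊢ gamma)
  | RAck p (Phi : seq formula) (Theta Theta' : set sequent) (c : sequent) :
      finite_set Theta ->
      (forall phi, List.In phi Phi -> ~~ occurs p phi) ->
      (forall s, Theta' s -> ~~ occurs_seq p s) ->
      (forall s, Theta s -> positive p (lhs s) /\ negative p (rhs s)) ->
      ~~ occurs_seq p c \/ positive_seq p c ->
      rule ([set s | exists2 phi, List.In phi Phi & s = (phi ⊢ Var p)]
              `|` Theta `|` Theta' ⇒ c)
           (subst_seq (bigOr Phi) p @` Theta `|` Theta'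
              ⇒ subst_seq (bigOr Phi) p c)
  | LAck p (Phi : seq formula) (Theta Theta' : set sequent) (c : sequent) :
      finite_set Theta ->
      (forall phi, List.In phi Phi -> ~~ occurs p phi) ->
      (forall s, Theta' s -> ~~ occurs_seq p s) ->
      (forall s, Theta s -> negative p (lhs s) /\ positive p (rhs s)) ->
      ~~ occurs_seq p c \/ negative_seq p c ->
      rule ([set s | exists2 phi, List.In phi Phi & s = (Var p ⊢ phi)]
              `|` Theta `|` Theta' ⇒ c)
           (subst_seq (bigAnd Phi) p @` Theta `|` Theta'
              ⇒ subst_seq (bigAnd Phi) p c).

Inductive fresh_rule (p : nat) : supersequent -> supersequent -> Prop :=
  | RuleApproximate s Gamma Theta c :
      approximate p s Gamma ->
      fresh_rule p (s |` Theta ⇒ c) (Gamma `|` Theta ⇒ c)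
  | RuleApproxConclL Theta phi psi :
      fresh_rule p (Theta ⇒ phi ⊢ psi)
                   ((Var p ⊢ phi) |` Theta ⇒ Var p ⊢ psi)
  | RuleApproxConclR Theta phi psi :
      fresh_rule p (Theta ⇒ phi ⊢ psi)
                   ((psi ⊢ Var p) |` Theta ⇒ phi ⊢ Var p).

(* [step H S T]: T follows from S, the last member of the derivation H.  When a
   rule introduces p, p must not occur in H; when the rule is used upwards, p
   occurs in S, hence in H, and freshness means that T is free of p. *)
Inductive step (H : seq supersequent) (S T : supersequent) : Prop :=
  | StepDown of rule S T
  | StepUp of rule T S
  | StepFreshDown p of fresh_rule p S T
      & (forall U, List.In U H -> ~ occurs_sup p U)
  | StepFreshUp p of fresh_rule p T S & ~ occurs_sup p T.

(* [derivation S0 H T]: H lists, last member first, the supersequents of a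
   derivation that starts at S0 and ends at T. *)
Inductive derivation (S0 : supersequent) :
    seq supersequent -> supersequent -> Prop :=
  | DerivStart : derivation S0 [:: S0] S0
  | DerivStep H S T :
      derivation S0 H S -> step H S T -> derivation S0 (T :: H) T.

Definition rule_derivable_in_ALC (S T : supersequent) : Prop :=
  exists H, derivation S H T.

(* Main.v *)
Require Import Defs.
From HB Require Import structures.
From mathcomp Require Import all_boot all_order.
From mathcomp Require Import boolp classical_sets functions cardinality.

(** Call a supersequent valid in a BDRG when every assignment that satisfies
    all its assumptions satisfies its conclusion.  A supersequent without
    assumptions is valid exactly when its conclusion is a valid sequent, so it
    is enough that every step of a derivation preserves validity in each BDRG,
    in both directions ([step_sound]).

    The splitting and residuation rules rewrite a sequent into sequents that
    the same assignments satisfy.  The rules that introduce a fresh variable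
    [p] are sound because the operations are monotone or antitone in each
    argument: the new assumptions imply the old one, and conversely an
    assignment that satisfies the old assumption satisfies the new ones once
    [p] is sent to the value of the formula it approximates, which disturbs
    nothing else since [p] is fresh.  The Ackermann rules rest on the fact that
    substituting [alpha] for [p] amounts to sending [p] to the value of [alpha]
    ([eval_subst]), and that a formula is monotone in the variables in which it
    is positive and antitone in those in which it is negative ([eval_signed]):
    the assumptions [phi_i ⊢ p] say that the value of [p] lies above that of
    the disjunction [alpha], so lowering it to [alpha] keeps the assumptions
    true, and raising it back keeps the conclusion true.  The other Ackermann
    rule is dual. *)

Set Implicit Arguments.
Unset Strict Implicit.
Unset Printing Implicit Defensive.

Import Order.LTheory.

Local Open Scope classical_set_scope.
Local Open Scope order_scope.

(** * Formulas under a change of one variable *)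

Section Soundness.
Variables (d : Order.disp_t) (A : bdrgType d).
Implicit Types (a b x y : A) (mu : nat -> A) (p : nat) (phi : formula).
Implicit Types (s c : sequent) (Theta : set sequent) (S T : supersequent).

Lemma fus_le2 a b x y : a <= b -> x <= y -> fus a x <= fus b y.
Proof.
move=> leab lexy; rewrite fus_cores (le_trans leab)// -fus_cores.
by rewrite fus_res (le_trans lexy)// -fus_res.
Qed.

Lemma res_le2 a b x y : b <= a -> x <= y -> res a x <= res b y.
Proof.
move=> leba lexy; rewrite -fus_res; apply: le_trans lexy.
by apply: (le_trans (fus_le2 leba (lexx _))); rewrite fus_res.
Qed.

Lemma cores_le2 a b x y : a <= b -> y <= x -> cores a x <= cores b y.
Proof.
move=> leab leyx; rewrite -fus_cores; apply: le_trans leab.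
by apply: (le_trans (fus_le2 (lexx _) leyx)); rewrite fus_cores.
Qed.

(** The assignment [mu] with the value of [p] changed to [a]. *)
Definition upd mu p a : nat -> A := fun q => if q == p then a else mu q.

Lemma upd_eq mu p a : upd mu p a p = a.
Proof. by rewrite /upd eqxx. Qed.

Lemma upd_id mu p : upd mu p (mu p) = mu.
Proof. by apply/funext => q; rewrite /upd; case: eqP => [->|]. Qed.

Lemma eval_upd_fresh mu p a phi :
  ~~ occurs p phi -> eval (upd mu p a) phi = eval mu phi.
Proof.
elim: phi => //= [q /negbTE qp|||||]; first by rewrite /upd qp.
all: by move=> phi IHphi psi IHpsi; rewrite negb_or => /andP[/IHphi -> /IHpsi ->].
Qed.

Lemma eval_subst mu p alpha phi :
  eval mu (subst alpha p phi) = eval (upd mu p (eval mu alpha)) phi.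
Proof.
elim: phi => //= [q|||||]; first by rewrite /upd; case: eqP.
all: by move=> phi -> psi ->.
Qed.

(** The value of a formula is monotone in the value of a variable in which it
    is positive, and antitone in that of one in which it is negative. *)
Lemma eval_signed mu p a b sg phi : a <= b -> signed sg p phi ->
  if sg then eval (upd mu p a) phi <= eval (upd mu p b) phi
  else eval (upd mu p b) phi <= eval (upd mu p a) phi.
Proof.
move=> leab; elim: phi sg => [q|||x IHx y IHy|x IHx y IHy|x IHx y IHy|
  x IHx y IHy|x IHx y IHy] sg /=.
- by rewrite /upd; case: sg; case: eqP => //=.
- by case: sg.
- by case: sg.
all: move=> /andP[/IHx + /IHy]; case: sg => /=.
1,2: exact: leI2.
1,2: exact: leU2.
1,2: exact: res_le2.
1,2: exact: fus_le2.
1,2: exact: cores_le2.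
Qed.

(** * Satisfaction of sequents *)

(** The assignment [mu] satisfies the sequent [s]. *)
Definition holds mu s : bool := eval mu (lhs s) <= eval mu (rhs s).

Definition satisfies mu Theta : Prop := forall s, Theta s -> holds mu s.

(** Validity of a supersequent, read as a quasi-inequality. *)
Definition supervalid S : Prop :=
  forall mu, satisfies mu (assumptions S) -> holds mu (conclusion S).

Lemma satisfiesU mu Theta Theta' :
  satisfies mu (Theta `|` Theta') <-> satisfies mu Theta /\ satisfies mu Theta'.
Proof.
split=> [sat|[sat sat'] s [/sat|/sat']//].
by split=> s ?; apply: sat; [left|right].
Qed.

Lemma satisfies1 mu s : satisfies mu [set s] <-> holds mu s.
Proof. by split=> [|hs t ->//]; apply. Qed.

Lemma satisfies2 mu s t :
  satisfies mu [set s; t] <-> holds mu s /\ holds mu t.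
Proof. by rewrite satisfiesU !satisfies1. Qed.

Lemma holds_upd_fresh mu p a s :
  ~~ occurs_seq p s -> holds (upd mu p a) s = holds mu s.
Proof. by rewrite negb_or => /andP[? ?]; rewrite /holds !eval_upd_fresh. Qed.

Lemma satisfies_upd_fresh mu p a Theta :
  (forall s, Theta s -> ~~ occurs_seq p s) ->
  satisfies (upd mu p a) Theta <-> satisfies mu Theta.
Proof.
by move=> fr; split=> sat s Ts; move: (sat s Ts); rewrite holds_upd_fresh ?fr.
Qed.

Lemma holds_subst mu p alpha s :
  holds mu (subst_seq alpha p s) = holds (upd mu p (eval mu alpha)) s.
Proof. by rewrite /holds /= !eval_subst. Qed.

Lemma satisfies_subst mu p alpha Theta :
  satisfies mu (subst_seq alpha p @` Theta) <->
  satisfies (upd mu p (eval mu alpha)) Theta.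
Proof.
split=> [sat s Ts|sat _ [s Ts <-]]; last by rewrite holds_subst; apply: sat.
by rewrite -holds_subst; apply: sat; exists s.
Qed.

Lemma holds_positive_seq mu p a b s : a <= b -> positive_seq p s ->
  holds (upd mu p a) s -> holds (upd mu p b) s.
Proof.
move=> leab /andP[/(eval_signed mu leab) lel /(eval_signed mu leab) ler] hs.
exact: le_trans lel (le_trans hs ler).
Qed.

Lemma holds_negative_seq mu p a b s : a <= b -> negative_seq p s ->
  holds (upd mu p b) s -> holds (upd mu p a) s.
Proof.
move=> leab /andP[/(eval_signed mu leab) lel /(eval_signed mu leab) ler] hs.
exact: le_trans lel (le_trans hs ler).
Qed.

Lemma eval_bigOr_le mu (Phi : seq formula) x : eval mu (bigOr Phi) <= x <->
  (forall phi, List.In phi Phi -> eval mu phi <= x).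
Proof.
case: Phi => [|phi Phi] /=; first by split=> // _; apply: le0x.
elim: Phi phi => [|psi Phi IH] phi /=.
  by split=> [le_x _ [<-|]//|]; apply; left.
rewrite IH /=; split=> le_x.
  have := le_x _ (or_introl erefl); rewrite /= leUx => /andP[? ?].
  by move=> xi [<-|[<-|]]// ?; apply: le_x; right.
move=> xi [<-|?] /=; last by apply: le_x; right; right.
by rewrite leUx !le_x//; [right; left|left].
Qed.

Lemma le_eval_bigAnd mu (Phi : seq formula) x : x <= eval mu (bigAnd Phi) <->
  (forall phi, List.In phi Phi -> x <= eval mu phi).
Proof.
case: Phi => [|phi Phi] /=; first by split=> // _; apply: lex1.
elim: Phi phi => [|psi Phi IH] phi /=.
  by split=> [x_le _ [<-|]//|]; apply; left.
rewrite IH /=; split=> x_le.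
  have := x_le _ (or_introl erefl); rewrite /= lexI => /andP[? ?].
  by move=> xi [<-|[<-|]]// ?; apply: x_le; right.
move=> xi [<-|?] /=; last by apply: x_le; right; right.
by rewrite lexI !x_le//; [right; left|left].
Qed.

(** * Soundness of the rules *)

Lemma split_residuate_sound mu s Gamma :
  split_residuate s Gamma -> holds mu s <-> satisfies mu Gamma.
Proof.
case=> phi psi gamma.
- by rewrite satisfies2 /holds /= lexI; split=> /andP.
- by rewrite satisfies2 /holds /= leUx; split=> /andP.
- by rewrite satisfies1 /holds /= fus_res.
- by rewrite satisfies1 /holds /= fus_cores.
Qed.

Lemma approximate_sound mu p s Gamma :
  approximate p s Gamma -> satisfies mu Gamma -> holds mu s.
Proof.
case=> phi psi gamma /satisfies2[]; rewrite /holds /= => le1 le2;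
  try (by apply: le_trans le2 _; apply: res_le2 || apply: fus_le2
       || apply: leU2);
  by apply: le_trans le2; apply: res_le2 || apply: fus_le2 || apply: leI2.
Qed.

Lemma approximate_complete mu p s Gamma :
  approximate p s Gamma -> ~~ occurs_seq p s -> holds mu s ->
  exists a, satisfies (upd mu p a) Gamma.
Proof.
(* [p] receives the value of the subformula that it approximates. *)
case=> phi psi gamma; rewrite /occurs_seq /= => fr;
  (have /and3P[fr1 fr2 fr3] :
    [&& ~~ occurs p phi, ~~ occurs p psi & ~~ occurs p gamma]
    by move: fr; case: (occurs p phi); case: (occurs p psi);
       case: (occurs p gamma));
  rewrite /holds /= => hs;
  [ exists (eval mu phi) | exists (eval mu psi) | exists (eval mu phi)
  | exists (eval mu psi) | exists (eval mu psi) | exists (eval mu gamma)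
  | exists (eval mu phi) | exists (eval mu psi) | exists (eval mu phi)
  | exists (eval mu psi) | exists (eval mu psi) | exists (eval mu gamma) ];
  by apply/satisfies2; rewrite /holds /= upd_eq !eval_upd_fresh// lexx.
Qed.

Lemma rule_sound S T : rule S T -> supervalid S <-> supervalid T.
Proof.
case=> {S T}.
- move=> s Gamma Theta c /split_residuate_sound ss; rewrite /supervalid /=.
  by split=> val mu; have := val mu; rewrite !satisfiesU satisfies1 ss.
- move=> Theta phi psi gamma; rewrite /supervalid /holds /=.
  by split=> val mu; have := val mu; rewrite fus_res.
- move=> Theta phi psi gamma; rewrite /supervalid /holds /=.
  by split=> val mu; have := val mu; rewrite fus_cores.
- move=> p Phi Theta Theta' c _ frPhi fr sgn sgnc; rewrite /supervalid /=.
  split=> val mu.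
    rewrite satisfiesU satisfies_subst holds_subst => -[satT satT'].
    apply: val; rewrite !satisfiesU (satisfies_upd_fresh _ _ fr); split=> //.
    split=> // _ [phi inPhi ->]; rewrite /holds /= upd_eq.
    by rewrite eval_upd_fresh ?frPhi//; apply: (eval_bigOr_le _ _ _).1 _ _ inPhi.
  (* The assumptions hold when [p] is lowered to the disjunction, so does the
     conclusion, and raising [p] back preserves it. *)
  rewrite !satisfiesU => -[[satPhi satT] satT'].
  have le_p : eval mu (bigOr Phi) <= mu p.
    apply/eval_bigOr_le => phi inPhi.
    by apply: (satPhi (phi ⊢ Var p)); exists phi.
  have : holds mu (subst_seq (bigOr Phi) p c).
    apply: val; rewrite satisfiesU satisfies_subst; split=> // s Ts.
    apply: (holds_negative_seq le_p); first by apply/andP/sgn.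
    by rewrite upd_id; apply: satT.
  rewrite holds_subst; case: sgnc => [frc|posc]; first by rewrite holds_upd_fresh.
  by move/(holds_positive_seq le_p posc); rewrite upd_id.
- move=> p Phi Theta Theta' c _ frPhi fr sgn sgnc; rewrite /supervalid /=.
  split=> val mu.
    rewrite satisfiesU satisfies_subst holds_subst => -[satT satT'].
    apply: val; rewrite !satisfiesU (satisfies_upd_fresh _ _ fr); split=> //.
    split=> // _ [phi inPhi ->]; rewrite /holds /= upd_eq.
    by rewrite eval_upd_fresh ?frPhi//; apply: (le_eval_bigAnd _ _ _).1 _ _ inPhi.
  rewrite !satisfiesU => -[[satPhi satT] satT'].
  have p_le : mu p <= eval mu (bigAnd Phi).
    apply/le_eval_bigAnd => phi inPhi.
    by apply: (satPhi (Var p ⊢ phi)); exists phi.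
  have : holds mu (subst_seq (bigAnd Phi) p c).
    apply: val; rewrite satisfiesU satisfies_subst; split=> // s Ts.
    apply: (holds_positive_seq p_le); first by apply/andP/sgn.
    by rewrite upd_id; apply: satT.
  rewrite holds_subst; case: sgnc => [frc|negc]; first by rewrite holds_upd_fresh.
  by move/(holds_negative_seq p_le negc); rewrite upd_id.
Qed.

(** The side condition bears on the member of the rule without the new
    variable, in whichever direction the rule is used. *)
Lemma fresh_rule_sound p S T :
  fresh_rule p S T -> ~ occurs_sup p S -> supervalid S <-> supervalid T.
Proof.
case=> {S T}.
- move=> s Gamma Theta c app /not_orP[/= frS /negP frc]; rewrite /supervalid /=.
  have frT t : Theta t -> ~~ occurs_seq p t.
    by move=> Tt; apply/negP => pt; apply: frS; exists t => //; right.
  have frs : ~~ occurs_seq p s.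
    by apply/negP => ps; apply: frS; exists s => //; left.
  split=> val mu; rewrite satisfiesU => -[satG satT].
    apply: val; rewrite satisfiesU satisfies1; split=> //.
    exact: approximate_sound app satG.
  have [a sata] := approximate_complete app frs ((satisfies1 _ _).1 satG).
  rewrite -(holds_upd_fresh mu a frc); apply: val.
  by rewrite satisfiesU (satisfies_upd_fresh _ _ frT).
- move=> Theta phi psi /not_orP[/= frS /negP].
  rewrite /occurs_seq /= negb_or => /andP[fr1 fr2].
  have frT t : Theta t -> ~~ occurs_seq p t.
    by move=> Tt; apply/negP => pt; apply: frS; exists t.
  rewrite /supervalid /=; split=> val mu.
    rewrite satisfiesU satisfies1 => -[lep satT].
    exact: le_trans lep (val mu satT).
  move=> satT; have := val (upd mu p (eval mu phi)).
  rewrite satisfiesU satisfies1 (satisfies_upd_fresh _ _ frT).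
  by rewrite /holds /= upd_eq !eval_upd_fresh//; apply.
- move=> Theta phi psi /not_orP[/= frS /negP].
  rewrite /occurs_seq /= negb_or => /andP[fr1 fr2].
  have frT t : Theta t -> ~~ occurs_seq p t.
    by move=> Tt; apply/negP => pt; apply: frS; exists t.
  rewrite /supervalid /=; split=> val mu.
    rewrite satisfiesU satisfies1 => -[lep satT].
    exact: le_trans (val mu satT) lep.
  move=> satT; have := val (upd mu p (eval mu psi)).
  rewrite satisfiesU satisfies1 (satisfies_upd_fresh _ _ frT).
  by rewrite /holds /= upd_eq !eval_upd_fresh//; apply.
Qed.

(** Downwards, [S] itself is a member of the derivation [H], which is free of
    the new variable. *)
Lemma step_sound (H : seq supersequent) S T :
  List.In S H -> step H S T -> supervalid S <-> supervalid T.
Proof.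
move=> inS [/rule_sound//|/rule_sound ST|p r fr|p r fr].
- by split=> /ST.
- by apply: fresh_rule_sound r _; apply: fr.
- by have ST := fresh_rule_sound r fr; split=> /ST.
Qed.

Lemma derivation_sound S (H : seq supersequent) T :
  derivation S H T -> supervalid S <-> supervalid T.
Proof.
move=> der; suff [] : List.In T H /\ (supervalid S <-> supervalid T) by [].
elim: der => [|{}H U {}T _ [inU SU] /(step_sound inU) UT] /=.
  by split=> //; left.
by split; [left|rewrite SU].
Qed.

Lemma supervalid0 s : supervalid (set0 ⇒ s) <-> valid A s.
Proof. by split=> [val mu|val mu _]; apply: val. Qed.

End Soundness.

Theorem proposition1 (phi psi chi delta : formula)
  (hSI : LSI_sequent (phi ⊢ psi))
  (hbullet : Lbullet_sequent (chi ⊢ delta))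
  (hderiv : rule_derivable_in_ALC (set0 ⇒ phi ⊢ psi) (set0 ⇒ chi ⊢ delta)) :
  algebraically_corresponds (phi ⊢ psi) (chi ⊢ delta).
Proof.
move=> d A; case: hderiv => H der.
by rewrite -!supervalid0; apply: derivation_sound der.
Qed.
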